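(* Let $f:\mathbb{R}^n\to\mathbb{R}$ satisfy the standing assumption in the context, let $\epsilon>0$, and let $\{x_t\}_{t\ge0}$ be generated by the normalized Armijo line search scheme $x_{t+1}=\mathcal{A}_{LS}(f,x_t,\bar\delta)$ with $\bar\delta>\sqrt\epsilon$. Let $x_T$ be the first iterate such that $\|\nabla f(x_T)\|\le\sqrt\epsilon$. Suppose that all search directions $v_t$ satisfy the gradient-related condition $\langle\nabla f(x_t),v_t\rangle\le-\alpha\|\nabla f(x_t)\|\|v_t\|$ with the same $\alpha\in(0,1]$. Put $\Delta_f:=f(x_0)-f^*$. Then $$R_T:=\max\{\|x_t-x_0\|:0\le t\le T\}\le\frac{\Delta_f}{\alpha\sigma\sqrt\epsilon}\qquad\text{and}\qquad T\le\mathcal{O}\Big(\frac{\Delta_f}{\epsilon}\cdot\mathcal{L}_1\big(B(x_0,R_T+\bar\delta)\big)\Big),$$ where $\mathcal{O}(\cdot)$ hides a constant depending only on $\theta,\sigma,\alpha$. Specifically, if the search directions are $v_t=-\nabla f(x_t)$, then the result holds with $\alpha=1$.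
   Context: Norms are Euclidean and $B(x,r)=\{y:\|y-x\|\le r\}$. Standing assumption: $f$ is continuously differentiable, $f^*:=\inf_xf(x)>-\infty$, and $\nabla f$ is locally but not globally Lipschitz. For each compact $C\subsetneq\mathbb{R}^n$, $\mathcal{L}_1(C)\ge1$ denotes the Lipschitz constant of $\nabla f$ on $C$, i.e. $\|\nabla f(x)-\nabla f(y)\|\le\mathcal{L}_1(C)\|x-y\|$ for $x,y\in C$; it is monotone in $C$. Normalized Armijo subroutine $\mathcal{A}_{LS}(f,x,\bar\delta)$, with fixed constants $\theta\in(0,1)$, $\sigma\in(0,1)$, $\bar\delta>0$: find a direction $v\ne0$ with $\langle\nabla f(x),v\rangle\le-\alpha\|\nabla f(x)\|\|v\|$; initialize $\delta=\bar\delta/\|v\|$; while $f(x+\delta v)>f(x)+\sigma\delta\langle\nabla f(x),v\rangle$, replace $\delta$ by $\theta\delta$; return $x+\delta v$ with the final $\delta$. No knowledge of Lipschitz constants is used. *)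

(* Defs.v *)
From HB Require Import structures.
From mathcomp Require Import all_boot all_order all_algebra.
From mathcomp Require Import all_classical all_reals all_analysis.

Set Implicit Arguments.
Unset Strict Implicit.
Unset Printing Implicit Defensive.

Import Order.TTheory GRing.Theory Num.Theory.
Import numFieldNormedType.Exports.

Local Open Scope classical_set_scope.
Local Open Scope ring_scope.

(* The library norm on 'rV[R]_n is the sup norm, so the Euclidean norm is
   defined here; both induce the same topology, hence the library notions of
   differentiability and continuity can be used as they are. *)
Definition dotp (R : realType) (n : nat) (u v : 'rV[R]_n) : R :=
  \sum_(i < n) u 0 i * v 0 i.

Definition enorm (R : realType) (n : nat) (u : 'rV[R]_n) : R :=
  Num.sqrt (dotp u u).

Definition ecball (R : realType) (n : nat) (x : 'rV[R]_n) (r : R) :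
    set 'rV[R]_n :=
  [set y | enorm (y - x) <= r].

Definition grad (R : realType) (n : nat) (f : 'rV[R]_n -> R) (x : 'rV[R]_n) :
    'rV[R]_n :=
  \row_(i < n) 'D_(delta_mx 0 i) f x.

Definition elipschitz (R : realType) (n : nat) (g : 'rV[R]_n -> 'rV[R]_n)
    (C : set 'rV[R]_n) (L : R) : Prop :=
  forall x y, C x -> C y -> enorm (g x - g y) <= L * enorm (x - y).

Definition standing_assumption (R : realType) (n : nat) (f : 'rV[R]_n -> R) :
    Prop :=
  [/\ forall x, differentiable f x,
      continuous (grad f),
      has_lbound (range f),
      forall x, exists r L, 0 < r /\ elipschitz (grad f) (ecball x r) L
    & ~ exists L, elipschitz (grad f) setT L].

(* The least Lipschitz constant of the gradient on C among those that are at
   least 1.  Under the standing assumption the set is nonempty for compact C;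
   otherwise [inf] may take its default value. *)
Definition L1 (R : realType) (n : nat) (f : 'rV[R]_n -> R)
    (C : set 'rV[R]_n) : R :=
  inf [set L | 1 <= L /\ elipschitz (grad f) C L].

Definition gap (R : realType) (n : nat) (f : 'rV[R]_n -> R) (x : 'rV[R]_n) :
    R :=
  f x - inf (range f).

Definition gradient_related (R : realType) (n : nat) (f : 'rV[R]_n -> R)
    (alpha : R) (x v : 'rV[R]_n) : Prop :=
  dotp (grad f x) v <= - alpha * enorm (grad f x) * enorm v.

(* [backtrack f theta sigma x v d d']: the while loop started with step size d
   terminates with step size d'. *)
Inductive backtrack (R : realType) (n : nat) (f : 'rV[R]_n -> R)
    (theta sigma : R) (x v : 'rV[R]_n) : R -> R -> Prop :=
| backtrack_stop (d : R) :
    f (x + d *: v) <= f x + sigma * d * dotp (grad f x) v ->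
    backtrack f theta sigma x v d d
| backtrack_shrink (d d' : R) :
    f (x + d *: v) > f x + sigma * d * dotp (grad f x) v ->
    backtrack f theta sigma x v (theta * d) d' ->
    backtrack f theta sigma x v d d'.

(* [armijo_LS f theta sigma dbar x v y]: with the direction v, the normalized
   line search at x terminates and returns y.  The gradient-related condition
   on v is kept separate. *)
Definition armijo_LS (R : realType) (n : nat) (f : 'rV[R]_n -> R)
    (theta sigma dbar : R) (x v y : 'rV[R]_n) : Prop :=
  v != 0 /\
  exists2 d, backtrack f theta sigma x v (dbar / enorm v) d & y = x + d *: v.

Definition first_small_grad (R : realType) (n : nat) (f : 'rV[R]_n -> R)
    (x : nat -> 'rV[R]_n) (eps : R) (T : nat) : Prop :=
  enorm (grad f (x T)) <= Num.sqrt eps /\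
  forall t, (t < T)%N -> Num.sqrt eps < enorm (grad f (x t)).

(* No iterate up to the t-th one passes the stopping test. *)
Definition running (R : realType) (n : nat) (f : 'rV[R]_n -> R)
    (x : nat -> 'rV[R]_n) (eps : R) (t : nat) : Prop :=
  forall s, (s <= t)%N -> Num.sqrt eps < enorm (grad f (x s)).

Definition excursion (R : realType) (n : nat) (x : nat -> 'rV[R]_n) (T : nat) :
    R :=
  \big[Num.max/0]_(t < T.+1) enorm (x t - x 0%N).

(* The first T with a small gradient exists and obeys both bounds, K being the
   constant hidden in the O(.). *)
Definition complexity_bound (R : realType) (n : nat) (f : 'rV[R]_n -> R)
    (x : nat -> 'rV[R]_n) (eps dbar sigma alpha K : R) : Prop :=
  exists T : nat,
    [/\ first_small_grad f x eps T,
        excursion x T <= gap f (x 0%N) / (alpha * sigma * Num.sqrt eps)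
      & T%:R <= K * (gap f (x 0%N) / eps
                       * L1 f (ecball (x 0%N) (excursion x T + dbar)))].

(* Main.v *)
Require Import Defs.
From mathcomp Require Import all_boot all_order all_algebra.
From mathcomp Require Import all_classical all_reals all_analysis.
From mathcomp Require Import ring lra.

Import Order.TTheory GRing.Theory Num.Theory.
Import numFieldNormedType.Exports.

Local Open Scope ring_scope.

(** The search is accepted either at its first trial step, of length
    [dbar > sqrt eps], or after rejecting a trial step [e *: v].  In both cases
    the Armijo test gives
    [f (x t.+1) <= f (x t) - alpha sigma (sqrt eps) |x t.+1 - x t|]
    as long as the gradient at [x t] is larger than [sqrt eps]: a step is paid
    for by a decrease of [f] proportional to its length.  Telescoping
    ([distance_le_decrease]) bounds the length of the path, hence the excursion,
    by [gap / (alpha sigma sqrt eps)].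

    For the number of iterations, steps have to be bounded from below
    ([armijo_decrease_const]).  Every trial point lies within [dbar] of an
    iterate, hence in the ball of radius [R_T + dbar] around [x 0].  If [L >= 1]
    is a Lipschitz constant of the gradient there, the mean value theorem gives
    [f (x + e v) <= f x + e <grad f x, v> + L e^2 |v|^2], so a rejected step has
    length at least [(1 - sigma) alpha (sqrt eps) / L], and the accepted one is
    [theta] times as long.  Therefore [f] decreases by at least
    [theta sigma (1 - sigma) alpha^2 eps / L] at each iteration, which bounds
    their number with the constant
    [1 / (theta sigma (1 - sigma) alpha^2)]; taking the infimum over [L] gives
    the bound in terms of [L1].

    The same count shows that a small gradient is reached at all
    ([small_grad_reached]): otherwise all iterates stay in one fixed ball, on
    which the gradient is Lipschitz by compactness
    ([locally_lipschitz_on_ball]), and [f] would decrease below its infimum. *)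

(** * Euclidean geometry *)

Section Euclidean.
Set Implicit Arguments.
Unset Strict Implicit.
Variables (R : realType) (n : nat).
Implicit Types (u v w : 'rV[R]_n) (a b : R).

Lemma dotpC u v : dotp u v = dotp v u.
Proof. by apply: eq_bigr => i _; rewrite mulrC. Qed.

Lemma dotpDl u v w : dotp (u + v) w = dotp u w + dotp v w.
Proof.
rewrite /dotp -big_split /=; apply: eq_bigr => i _.
by rewrite mxE mulrDl.
Qed.

Lemma dotpZl a u v : dotp (a *: u) v = a * dotp u v.
Proof.
rewrite /dotp mulr_sumr; apply: eq_bigr => i _.
by rewrite mxE mulrA.
Qed.

Lemma dotpNl u v : dotp (- u) v = - dotp u v.
Proof. by rewrite -scaleN1r dotpZl mulN1r. Qed.

Lemma dotpBl u v w : dotp (u - v) w = dotp u w - dotp v w.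
Proof. by rewrite dotpDl dotpNl. Qed.

Lemma dotpDr u v w : dotp u (v + w) = dotp u v + dotp u w.
Proof. by rewrite dotpC dotpDl !(dotpC u). Qed.

Lemma dotpZr a u v : dotp u (a *: v) = a * dotp u v.
Proof. by rewrite dotpC dotpZl dotpC. Qed.

Lemma dotpNr u v : dotp u (- v) = - dotp u v.
Proof. by rewrite dotpC dotpNl dotpC. Qed.

Lemma dotpp_ge0 u : 0 <= dotp u u.
Proof. by apply: sumr_ge0 => i _; rewrite -expr2 sqr_ge0. Qed.

Lemma enorm_ge0 u : 0 <= enorm u.
Proof. exact: sqrtr_ge0. Qed.

Lemma sqr_enorm u : enorm u ^+ 2 = dotp u u.
Proof. by rewrite sqr_sqrtr // dotpp_ge0. Qed.

Lemma enorm_eq0 u : (enorm u == 0) = (u == 0).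
Proof.
apply/eqP/eqP => [u0|->]; last first.
  by rewrite /enorm /dotp big1 ?sqrtr0 // => i _; rewrite mxE mul0r.
have /eqP : dotp u u = 0 by rewrite -sqr_enorm u0 expr0n.
rewrite psumr_eq0 => [/allP u2|i _]; last by rewrite -expr2 sqr_ge0.
apply/rowP => i; rewrite mxE; apply/eqP.
by have := u2 i (mem_index_enum _); rewrite mulf_eq0 orbb.
Qed.

Lemma enormZ a u : enorm (a *: u) = `|a| * enorm u.
Proof.
by rewrite /enorm dotpZl dotpZr mulrA -expr2 sqrtrM ?sqr_ge0 // sqrtr_sqr.
Qed.

Lemma enormN u : enorm (- u) = enorm u.
Proof. by rewrite -scaleN1r enormZ normrN1 mul1r. Qed.

Lemma enormBC u v : enorm (u - v) = enorm (v - u).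
Proof. by rewrite -enormN opprB. Qed.

(** The Cauchy-Schwarz inequality, read off from the nonnegativity of
    [dotp w w] for [w := |v| u - |u| v]. *)
Lemma dotp_le_enorm u v : dotp u v <= enorm u * enorm v.
Proof.
have [u0|u0] := eqVneq u 0.
  by rewrite u0 -(scale0r 0) dotpZl mul0r mulr_ge0 ?enorm_ge0.
have [v0|v0] := eqVneq v 0.
  by rewrite v0 -(scale0r 0) dotpZr mul0r mulr_ge0 ?enorm_ge0.
have up : 0 < enorm u by rewrite lt_def enorm_eq0 u0 enorm_ge0.
have vp : 0 < enorm v by rewrite lt_def enorm_eq0 v0 enorm_ge0.
have := dotpp_ge0 (enorm v *: u - enorm u *: v).
rewrite dotpBl !dotpDr !dotpNr !dotpZl !dotpZr -!sqr_enorm (dotpC v u) => h.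
rewrite -subr_ge0 -(pmulr_rge0 _ (mulr_gt0 up vp)) -(pmulr_rge0 _ (ltr0n R 2)).
by apply: le_trans h _; rewrite le_eqVlt; apply/orP; left; apply/eqP; ring.
Qed.

Lemma enormD u v : enorm (u + v) <= enorm u + enorm v.
Proof.
rewrite -(ler_pXn2r (n := 2)) ?nnegrE ?addr_ge0 ?enorm_ge0 //.
rewrite sqr_enorm dotpDl !dotpDr (dotpC v u) -!sqr_enorm.
have := dotp_le_enorm u v; lra.
Qed.

Lemma enorm_dist u v w : enorm (u - w) <= enorm (u - v) + enorm (v - w).
Proof. by apply: le_trans (enormD _ _); rewrite addrA subrK. Qed.

Lemma ler_coord_enorm u i : `|u 0 i| <= enorm u.
Proof.
rewrite -(ler_pXn2r (n := 2)) ?nnegrE ?enorm_ge0 // sqr_enorm real_normK ?num_real //.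
rewrite /dotp (bigD1 i) //= -expr2 lerDl.
by apply: sumr_ge0 => j _; rewrite -expr2 sqr_ge0.
Qed.

(** The topology comes from the sup norm, and a vector with all coordinates at
    most [d] has Euclidean norm at most [sqrt n * d <= n.+1 * d]; using [n.+1]
    avoids a division by zero in dimension 0. *)
Lemma near_enorm u e : 0 < e -> \forall v \near u, enorm (v - u) <= e.
Proof.
move=> e0; pose d := e / n.+1%:R.
have d0 : 0 < d by rewrite divr_gt0 ?ltr0n.
apply/nbhs_ballP; exists d => //= v uv.
have uvd i : (v - u) 0 i ^+ 2 <= d ^+ 2.
  rewrite -real_normK ?num_real // ler_pXn2r ?nnegrE ?(ltW d0) //.
  by rewrite !mxE distrC; exact: ltW (uv.2 0 i).
rewrite -(ler_pXn2r (n := 2)) ?nnegrE ?enorm_ge0 ?(ltW e0) // sqr_enorm.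
have -> : e = n.+1%:R * d by rewrite mulrC divfK ?pnatr_eq0.
apply: (@le_trans _ _ (n%:R * d ^+ 2)).
  rewrite mulr_natl -[X in _ *+ X](card_ord n) -sumr_const.
  by apply: ler_sum => i _; rewrite -expr2.
rewrite (exprMn 2 n.+1%:R d) ler_wpM2r ?sqr_ge0 // -natrX ler_nat.
by rewrite (leq_trans (leqnSn n)) // leq_pmulr.
Qed.

End Euclidean.

(** * Locally Lipschitz maps on balls *)

Section LocallyLipschitz.
Set Implicit Arguments.
Unset Strict Implicit.
Variables (R : realType) (n : nat) (g : 'rV[R]_n -> 'rV[R]_n).

Local Open Scope classical_set_scope.

Lemma ecball_center (x : 'rV[R]_n) r : 0 <= r -> ecball x r x.
Proof.
by move=> r0; rewrite /ecball /= subrr -(scale0r 0) enormZ normr0 mul0r.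
Qed.

(** Compactness is used in the form of near-coverings: a property [P L p] that
    holds for all [p] near each point and all large [L] holds with a single [L]
    on a whole compact set.  Since two points of the ball may be far apart, [P]
    combines a Lipschitz estimate at distance at most [1 / L] with a bound on
    [g], which settles the pairs at larger distance. *)
Lemma locally_lipschitz_on_ball :
  (forall p, exists r L, 0 < r /\ elipschitz g (ecball p r) L) ->
  forall x r, exists L, 1 <= L /\ elipschitz g (ecball x r) L.
Proof.
move=> locg x r.
pose cube := [set y : 'rV[R]_n | forall i, `[x 0 i - r, x 0 i + r] (y 0 i)].
have cube_ball : ecball x r `<=` cube.
  move=> y yr i /=; rewrite in_itv /=.
  have := le_trans (ler_coord_enorm (y - x) i) yr.
  by rewrite !mxE ler_norml => /andP[? ?]; apply/andP; split; lra.
have : compact cube.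
  apply: (@rV_compact R n (fun i => `[x 0 i - r, x 0 i + r])) => i.
  exact: segment_compact.
pose P (L : R) (p : 'rV[R]_n) := enorm (g p) <= L /\
  forall q, L * enorm (p - q) <= 1 -> enorm (g p - g q) <= L * enorm (p - q).
move=> /compact_near_coveringP/(_ R +oo P _) nearP.
have {nearP} : \forall L \near +oo, cube `<=` P L.
  apply: nearP => p _; have [rp [Lp [rp0 gp]]] := locg p.
  pose M := enorm (g p) + `|Lp| * rp + `|Lp| + 2 / rp.
  suff localP q L : enorm (q - p) <= rp / 2 -> M <= L -> P L q.
    have near_p : \forall q \near p, enorm (q - p) <= rp / 2.
      by apply: near_enorm; rewrite divr_gt0.
    have large : \forall L \near +oo, M <= L.
      by apply: nbhs_pinfty_ge; rewrite num_real.
    near=> q L.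
    have pq : enorm (q - p) <= rp / 2 by near: q.
    have ML : M <= L by near: L.
    exact: localP.
  rewrite /M => pq ML {M}.
  have pball : ecball p rp p by apply: ecball_center; exact: ltW.
  have qball : ecball p rp q by rewrite /ecball /=; lra.
  have gp0 := enorm_ge0 (g p).
  have Lprp : 0 <= `|Lp| * rp by rewrite mulr_ge0 // ltW.
  have rpV : 0 < 2 / rp by rewrite divr_gt0.
  have Lp0 := normr_ge0 Lp.
  split.
    have gqp := enormD (g q - g p) (g p); rewrite subrK in gqp.
    have lip := gp _ _ qball pball.
    have : Lp * enorm (q - p) <= `|Lp| * rp.
      apply: (le_trans (ler_wpM2r (enorm_ge0 _) (ler_norm Lp))).
      by rewrite ler_wpM2l // qball.
    lra.
  move=> q' Lq.
  have qq' : enorm (q - q') <= rp / 2.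
    have h : 2 / rp * enorm (q - q') <= 1.
      by apply: le_trans Lq; rewrite ler_wpM2r ?enorm_ge0 //; lra.
    rewrite -(ler_pM2l rpV); apply: (le_trans h).
    by rewrite mulrA divfK ?gt_eqF // divff.
  have q'ball : ecball p rp q'.
    rewrite /ecball /=; apply: le_trans (enorm_dist q' q p) _.
    by rewrite enormBC; lra.
  apply: le_trans (gp _ _ qball q'ball) _.
  by rewrite ler_wpM2r ?enorm_ge0 //; apply: le_trans (ler_norm _) _; lra.
have large1 : \forall L \near +oo, 1 <= L :> R by exact: nbhs_pinfty_ge.
move=> cubeP; have [L [L1 cubeL]] := filter_ex (filterI large1 cubeP).
have {cube_ball cubeP cubeL} ballP : ecball x r `<=` P L.
  exact: subset_trans cube_ball cubeL.
(* At distance more than [1 / L], [|g y - g z| <= 2 L <= 2 L^2 |y - z|]. *)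
exists (2 * L ^+ 2).
have LL : L <= L ^+ 2 by rewrite expr2 ler_peMr // (le_trans ler01).
split=> [|y z /ballP[gy gyz] /ballP[gz _]]; first by lra.
have [yz|yz] := leP (L * enorm (y - z)) 1.
  apply: le_trans (gyz z yz) _; rewrite ler_wpM2r ?enorm_ge0 //; lra.
have : enorm (g y - g z) <= 2 * L.
  by have := enormD (g y) (- g z); rewrite enormN; lra.
move=> /le_trans; apply; rewrite expr2 !mulrA -mulrA ler_peMr ?(ltW yz) //; lra.
Unshelve. all: by end_near. Qed.

End LocallyLipschitz.

(** * Mean value estimates along segments *)

Section MeanValue.
Set Implicit Arguments.
Unset Strict Implicit.
Variables (R : realType) (n : nat) (f : 'rV[R]_n -> R).

Lemma deriveE_grad x w : differentiable f x -> 'D_w f x = dotp (grad f x) w.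
Proof.
move=> dfx; rewrite deriveE // [w in 'd f x w]row_sum_delta linear_sum /=.
apply: eq_bigr => i _.
by rewrite linearZ /= mxE deriveE // mulrC.
Qed.

Lemma mean_value_segment x w : (forall y, differentiable f y) ->
  exists2 c : R, 0 <= c <= 1 & f (x + w) - f x = dotp (grad f (x + c *: w)) w.
Proof.
move=> df; pose h (c : R) := f (x + c *: w).
(* The difference quotients of [h] at [c] are those of [f] at [x + c *: w] in
   direction [w], so [h] inherits its derivatives from [f]. *)
have quotE (c : R) : (fun t : R => t^-1 *: ((h \o shift c) (t *: 1) - h c)) =
    (fun t : R => t^-1 *: ((f \o shift (x + c *: w)) (t *: w) - f (x + c *: w))).
  apply/funext => t /=; rewrite /h; congr (_ *: (f _ - _)).
  by rewrite scalerDl -scalerA scale1r addrCA.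
have dh (c : R) : is_derive c 1 h (dotp (grad f (x + c *: w)) w).
  apply: DeriveDef; first by rewrite /derivable quotE; exact: diff_derivable.
  by rewrite /derive quotE -deriveE_grad.
have [|c c01] :=
  @MVT_segment R h (fun c => dotp (grad f (x + c *: w)) w) 0 1 ler01.
  by apply: derivable_within_continuous => c _; case: (dh c).
rewrite subr0 mulr1 /h scale1r scale0r addr0 => fE.
by exists c => //; move: c01; rewrite in_itv.
Qed.

(** First-order expansion with quadratic error, from the mean value theorem and
    the Cauchy-Schwarz inequality.  Integrating along the segment would give
    [L / 2] instead of [L], a gain of a factor that is absorbed by the
    constant of the complexity bound. *)
Lemma lipschitz_grad_quadratic x w r L : (forall y, differentiable f y) ->
  0 <= L -> elipschitz (grad f) (ecball x r) L -> enorm w <= r ->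
  f (x + w) <= f x + dotp (grad f x) w + L * enorm w ^+ 2.
Proof.
move=> df L0 lipL wr; have [c /andP[c0 c1] fE] := mean_value_segment x w df.
have cw : enorm (c *: w) <= enorm w.
  by rewrite enormZ ger0_norm // ler_piMl // enorm_ge0.
have x0 : ecball x r x := ecball_center x (le_trans (enorm_ge0 w) wr).
have xc : ecball x r (x + c *: w).
  by rewrite /ecball /= [x + _]addrC addrK; exact: le_trans cw wr.
have lip := lipL _ _ xc x0; rewrite [x + _ - x]addrAC subrr add0r in lip.
have cs := dotp_le_enorm (grad f (x + c *: w) - grad f x) w.
rewrite dotpBl in cs.
suff : enorm (grad f (x + c *: w) - grad f x) * enorm w <=
  L * enorm w ^+ 2 by lra.
rewrite expr2 mulrA ler_wpM2r ?enorm_ge0 //; apply: le_trans lip _.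
by rewrite ler_wpM2l.
Qed.

End MeanValue.

(** * One line search *)

Section LineSearch.
Set Implicit Arguments.
Unset Strict Implicit.
Variables (R : realType) (n : nat) (f : 'rV[R]_n -> R).
Variables (theta sigma : R).
Hypotheses (theta01 : 0 < theta < 1) (sigma01 : 0 < sigma < 1).

Lemma backtrack_decrease x v d d' : backtrack f theta sigma x v d d' ->
  f (x + d' *: v) <= f x + sigma * d' * dotp (grad f x) v.
Proof. by elim. Qed.

Lemma backtrack_rejected x v d d' : 0 < d -> backtrack f theta sigma x v d d' ->
  d' = d \/ exists e, [/\ 0 < e, e <= d, d' = theta * e &
    f x + sigma * e * dotp (grad f x) v < f (x + e *: v)].
Proof.
case/andP: theta01 => t0 t1 d0 bt; elim: bt d0 => {d d'} [d _ _|d d' rej _ IH d0].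
  by left.
right; have [->|[e [e0 ed -> rej']]] := IH (mulr_gt0 t0 d0); first by exists d.
exists e; split=> //; apply: le_trans ed _.
by rewrite ler_piMl // ltW.
Qed.

Lemma backtrack_gt0 x v d d' : 0 < d -> backtrack f theta sigma x v d d' -> 0 < d'.
Proof.
case/andP: theta01 => t0 _ d0 /(backtrack_rejected d0)[->//|[e [e0 _ -> _]]].
exact: mulr_gt0.
Qed.

Variables (alpha s dbar : R) (x v y : 'rV[R]_n).
Hypotheses (alpha01 : 0 < alpha <= 1) (s0 : 0 < s) (s_dbar : s < dbar).
Hypotheses (s_grad : s < enorm (grad f x)).
Hypotheses (grv : gradient_related f alpha x v).
Hypotheses (ls : armijo_LS f theta sigma dbar x v y).

Let slope : alpha * s * enorm v <= - dotp (grad f x) v.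
Proof.
case/andP: alpha01 => a0 _.
have : alpha * s * enorm v <= alpha * enorm (grad f x) * enorm v.
  by rewrite ler_wpM2r ?enorm_ge0 // ler_wpM2l ?ltW.
by move: grv; rewrite /gradient_related !mulNr; lra.
Qed.

(** Each step pays for its own length: the Armijo test compares with
    [sigma d <grad f x, v>], which is at most [- alpha sigma s] times the length
    [d |v|] of the step. *)
Lemma armijo_decrease_length : f y <= f x - alpha * sigma * s * enorm (y - x).
Proof.
case/andP: sigma01 => sg0 _.
case: ls => v0 [d bt ->].
have v_gt0 : 0 < enorm v by rewrite lt_def enorm_eq0 v0 enorm_ge0.
have d0 : 0 < d by apply: (backtrack_gt0 _ bt); rewrite divr_gt0 // (lt_trans s0).
apply: le_trans (backtrack_decrease bt) _.
rewrite [x + _ - x]addrAC subrr add0r enormZ gtr0_norm //.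
have := ler_wpM2l (ltW (mulr_gt0 sg0 d0)) slope.
lra.
Qed.

(** A first trial step that is accepted has length [dbar > s].  Otherwise some
    rejected step [e *: v] stays in the ball of radius [dbar], and comparing its
    rejection with the quadratic expansion shows that its length is at least
    [(1 - sigma) alpha s / L]. *)
Lemma armijo_decrease_const L : 1 <= L -> (forall z, differentiable f z) ->
  elipschitz (grad f) (ecball x dbar) L ->
  f y <= f x - theta * sigma * (1 - sigma) * alpha ^+ 2 * s ^+ 2 / L.
Proof.
move=> L1 df lipL.
case/andP: sigma01 => sg0 sg1; case/andP: alpha01 => a0 a1.
case/andP: theta01 => t0 t1.
have L0 : 0 < L by lra.
have dbar0 : 0 < dbar := lt_trans s0 s_dbar.
apply: le_trans armijo_decrease_length _; rewrite lerD2l lerN2.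
(* By the previous lemma it is enough to bound the step length from below. *)
suff len : theta * ((1 - sigma) * alpha * s / L) <= enorm (y - x).
  apply: le_trans (ler_wpM2l _ len).
    by rewrite le_eqVlt; apply/orP; left; apply/eqP; ring.
  by rewrite !mulr_ge0 // ltW.
case: ls => v0 [d bt ->].
have v_gt0 : 0 < enorm v by rewrite lt_def enorm_eq0 v0 enorm_ge0.
rewrite [x + _ - x]addrAC subrr add0r enormZ.
have [->|[e [e0 ed -> rej]]] := backtrack_rejected (divr_gt0 dbar0 v_gt0) bt.
  rewrite gtr0_norm ?divr_gt0 // divfK ?gt_eqF //.
  apply: ltW; apply: le_lt_trans s_dbar.
  have -> : theta * ((1 - sigma) * alpha * s / L) =
    theta * (1 - sigma) * alpha * L^-1 * s by ring.
  rewrite ler_piMl ?(ltW s0) // !mulr_ile1 ?mulr_ge0 ?invr_ge0 ?invf_le1 //; lra.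
rewrite gtr0_norm ?mulr_gt0 // -(mulrA theta e) ler_pM2l //.
have ev : enorm (e *: v) = e * enorm v by rewrite enormZ gtr0_norm.
have ev_dbar : enorm (e *: v) <= dbar by rewrite ev -ler_pdivlMr.
have := lipschitz_grad_quadratic df (ltW L0) lipL ev_dbar.
rewrite dotpZr ev ler_pdivrMr // => quad.
rewrite -(ler_pM2l (mulr_gt0 e0 v_gt0)).
have sl : (1 - sigma) * e * (alpha * s * enorm v) <=
    (1 - sigma) * e * - dotp (grad f x) v.
  by rewrite ler_wpM2l // mulr_ge0 //; lra.
lra.
Qed.

End LineSearch.

(** * The sequence of iterates *)

Section Iterates.
Set Implicit Arguments.
Unset Strict Implicit.
Variables (R : realType) (n : nat) (f : 'rV[R]_n -> R).
Variables (theta sigma alpha eps dbar : R) (x v : nat -> 'rV[R]_n).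
Hypotheses (theta01 : 0 < theta < 1) (sigma01 : 0 < sigma < 1).
Hypotheses (alpha01 : 0 < alpha <= 1).
Hypotheses (eps0 : 0 < eps) (eps_dbar : Num.sqrt eps < dbar).
Hypotheses (fP : standing_assumption f).
Hypothesis step : forall t : nat, running f x eps t ->
  gradient_related f alpha (x t) (v t) /\
  armijo_LS f theta sigma dbar (x t) (v t) (x t.+1).

Let big_grad T := forall t, (t < T)%N -> Num.sqrt eps < enorm (grad f (x t)).

Let rate := theta * sigma * (1 - sigma) * alpha ^+ 2.

Let s0 : 0 < Num.sqrt eps. Proof. by rewrite sqrtr_gt0. Qed.

Let rate_gt0 : 0 < rate.
Proof.
case/andP: theta01 => ? _; case/andP: sigma01 => ? ?; case/andP: alpha01 => ? _.
by rewrite /rate !mulr_gt0 ?exprn_gt0 ?subr_gt0.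
Qed.

Let slope_gt0 : 0 < alpha * sigma * Num.sqrt eps.
Proof.
by case/andP: sigma01 => ? ?; case/andP: alpha01 => ? _; rewrite !mulr_gt0.
Qed.

Let running_lt T t : big_grad T -> (t < T)%N -> running f x eps t.
Proof. by move=> big tT i it; apply: big; exact: leq_ltn_trans tT. Qed.

Lemma decrease_le_gap y : f (x 0%N) - f y <= gap f (x 0%N).
Proof.
case: fP => _ _ lbf _ _; rewrite /gap lerD2l lerN2.
by apply: ge_inf => //; exists y.
Qed.

(** A step increases the distance to the starting point by at most its length,
    which is paid for by the decrease of [f]; these decreases telescope. *)
Lemma distance_le_decrease T : big_grad T -> forall t, (t <= T)%N ->
  enorm (x t - x 0%N) <= (f (x 0%N) - f (x t)) / (alpha * sigma * Num.sqrt eps).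
Proof.
move=> big; elim=> [_|t IH tT].
  by rewrite !subrr mul0r -(scale0r 0) enormZ normr0 mul0r.
have [gr ls] := step (running_lt big tT).
have dec :=
  armijo_decrease_length theta01 sigma01 alpha01 s0 eps_dbar (big _ tT) gr ls.
have dist := enorm_dist (x t.+1) (x t) (x 0%N).
move: (IH (ltnW tT)); rewrite !ler_pdivlMr // => IHt.
have := ler_wpM2r (ltW slope_gt0) dist; lra.
Qed.

Lemma distance_le_gap T t : big_grad T -> (t <= T)%N ->
  enorm (x t - x 0%N) <= gap f (x 0%N) / (alpha * sigma * Num.sqrt eps).
Proof.
move=> big tT; apply: le_trans (distance_le_decrease big tT) _.
by rewrite ler_wpM2r ?invr_ge0 ?(ltW slope_gt0) // decrease_le_gap.
Qed.

Lemma excursion_le_gap T : big_grad T ->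
  excursion x T <= gap f (x 0%N) / (alpha * sigma * Num.sqrt eps).
Proof.
move=> big; apply/bigmax_leP; split=> [|t _].
  exact: le_trans (enorm_ge0 _) (distance_le_gap big (leq0n T)).
by apply: distance_le_gap big _; rewrite -ltnS.
Qed.

Lemma distance_le_excursion T t : (t <= T)%N ->
  enorm (x t - x 0%N) <= excursion x T.
Proof.
rewrite -ltnS => tT.
exact: (le_bigmax _ (fun t : 'I_T.+1 => enorm (x t - x 0%N)) (Ordinal tT)).
Qed.

(** The trial points of an iterate within [r] of [x 0] stay in the ball of
    radius [r + dbar], so every iteration decreases [f] by at least
    [rate * eps / L], and the total decrease is at most the gap.  The radius [r]
    is a parameter: it is the excursion in the final bound, but an a priori
    bound on it in the proof that the iteration stops. *)
Lemma iterations_le_gap T r L : big_grad T ->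
  (forall t, (t < T)%N -> enorm (x t - x 0%N) <= r) ->
  1 <= L -> elipschitz (grad f) (ecball (x 0%N) (r + dbar)) L ->
  T%:R <= rate^-1 * (gap f (x 0%N) / eps * L).
Proof.
move=> big near_x0 L1 lipL; have L0 : 0 < L := lt_le_trans ltr01 L1.
suff dec : T%:R * (rate * eps / L) <= f (x 0%N) - f (x T).
  have -> : rate^-1 * (gap f (x 0%N) / eps * L) =
      gap f (x 0%N) / (rate * eps / L).
    by rewrite !invfM invrK; ring.
  rewrite (ler_pdivlMr _ _ (divr_gt0 (mulr_gt0 rate_gt0 eps0) L0)).
  exact: le_trans dec (decrease_le_gap _).
suff : forall t, (t <= T)%N -> t%:R * (rate * eps / L) <= f (x 0%N) - f (x t).
  by move=> /(_ T (leqnn T)).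
elim=> [_|t IH tT]; first by rewrite mul0r subrr.
have [gr ls] := step (running_lt big tT).
have [df _ _ _ _] := fP.
have lip_t : elipschitz (grad f) (ecball (x t) dbar) L.
  have sub y : ecball (x t) dbar y -> ecball (x 0%N) (r + dbar) y.
    move=> yt; apply: le_trans (enorm_dist y (x t) _) _.
    by rewrite addrC lerD // near_x0.
  by move=> y z /sub yb /sub zb; exact: lipL.
have := armijo_decrease_const theta01 sigma01 alpha01 s0 eps_dbar (big _ tT)
  gr ls L1 df lip_t.
rewrite sqr_sqrtr ?(ltW eps0) // -/rate mulrSr mulrDl mul1r.
by have := IH (ltnW tT); lra.
Qed.

(** If the iteration never stopped, the a priori bound on the distances would
    give one Lipschitz constant for all steps, hence a bound on the number of
    iterations. *)
Lemma small_grad_reached : exists T, enorm (grad f (x T)) <= Num.sqrt eps.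
Proof.
apply: contrapT => /forallNP never.
have big T : big_grad T by move=> t _; rewrite ltNge; apply/negP.
have [_ _ _ locL _] := fP.
pose r := gap f (x 0%N) / (alpha * sigma * Num.sqrt eps).
have [L [L1 lipL]] := locally_lipschitz_on_ball locL (x 0%N) (r + dbar).
pose N := Num.bound (rate^-1 * (gap f (x 0%N) / eps * L)).
have near_x0 t : (t < N)%N -> enorm (x t - x 0%N) <= r.
  by move=> /ltnW; exact: distance_le_gap.
have := iterations_le_gap (big N) near_x0 L1 lipL.
have : 0 <= rate^-1 * (gap f (x 0%N) / eps * L).
  exact: le_trans (iterations_le_gap (big 0%N) _ L1 lipL).
by move=> /archi_boundP /lt_le_trans h /h; rewrite ltxx.
Qed.

(** [iterations_le_gap] holds for every admissible Lipschitz constant, so it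
    passes to their infimum [L1]; that there is an admissible constant, so that
    the infimum is the intended one, is [locally_lipschitz_on_ball]. *)
Lemma armijo_complexity : complexity_bound f x eps dbar sigma alpha rate^-1.
Proof.
have [T smallT minT] := ex_minnP small_grad_reached.
have big : big_grad T.
  by move=> t tT; rewrite ltNge; apply/negP => /minT; rewrite leqNgt tT.
exists T; split=> //; first exact: excursion_le_gap.
have near_x0 t : (t < T)%N -> enorm (x t - x 0%N) <= excursion x T.
  by move=> /ltnW; exact: distance_le_excursion.
have gap_ge0 : 0 <= gap f (x 0%N).
  by rewrite -(subrr (f (x 0%N))) decrease_le_gap.
(* Passing to the infimum divides by the gap; if it is 0, then so is [T]. *)
have [gap0|gap_neq0] := eqVneq (gap f (x 0%N)) 0.
  have [_ _ _ locL _] := fP.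
  have [L [L1 lipL]] :=
    locally_lipschitz_on_ball locL (x 0%N) (excursion x T + dbar).
  by have := iterations_le_gap big near_x0 L1 lipL; rewrite gap0 !mul0r.
have k0 : 0 < rate^-1 * (gap f (x 0%N) / eps).
  by rewrite mulr_gt0 ?invr_gt0 // divr_gt0 // lt_def gap_neq0.
rewrite mulrA mulrC -ler_pdivrMr //; apply: lb_le_inf.
  have [_ _ _ locL _] := fP.
  exact: locally_lipschitz_on_ball.
move=> L [L1 lipL]; rewrite ler_pdivrMr // mulrC -mulrA.
exact: iterations_le_gap near_x0 L1 lipL.
Qed.

End Iterates.

Theorem theorem3p3 (R : realType) :
  exists K : R -> R -> R -> R,
    forall theta sigma : R,
      0 < theta < 1 -> 0 < sigma < 1 ->
      (forall alpha : R, 0 < alpha <= 1 ->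
         0 < K theta sigma alpha /\
         forall (n : nat) (f : 'rV[R]_n -> R) (eps dbar : R)
                (x v : nat -> 'rV[R]_n),
           standing_assumption f ->
           0 < eps ->
           Num.sqrt eps < dbar ->
           (forall t : nat, running f x eps t ->
              gradient_related f alpha (x t) (v t) /\
              armijo_LS f theta sigma dbar (x t) (v t) (x t.+1)) ->
           complexity_bound f x eps dbar sigma alpha (K theta sigma alpha)) /\
      (forall (n : nat) (f : 'rV[R]_n -> R) (eps dbar : R)
              (x : nat -> 'rV[R]_n),
         standing_assumption f ->
         0 < eps ->
         Num.sqrt eps < dbar ->
         (forall t : nat, running f x eps t ->
            armijo_LS f theta sigma dbar (x t) (- grad f (x t)) (x t.+1)) ->
         complexity_bound f x eps dbar sigma 1 (K theta sigma 1)).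
Proof.
exists (fun theta sigma alpha => (theta * sigma * (1 - sigma) * alpha ^+ 2)^-1).
move=> theta sigma theta01 sigma01; split.
  move=> alpha alpha01; split=> [|n f eps dbar x v fP eps0 eps_dbar step].
    case/andP: theta01 => ? _; case/andP: sigma01 => ? ?; case/andP: alpha01 => ? _.
    by rewrite invr_gt0 !mulr_gt0 ?exprn_gt0 ?subr_gt0.
  exact: armijo_complexity step.
move=> n f eps dbar x fP eps0 eps_dbar step.
apply: (@armijo_complexity _ _ _ _ _ _ _ _ _ (fun t => - grad f (x t))) => //.
  by rewrite ltr01 lexx.
move=> t run; split; last exact: step.
by rewrite /gradient_related dotpNr -sqr_enorm enormN mulN1r mulNr expr2.
Qed.
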